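(* Let $M\subset N$ be an extension of commutative cancellative torsion-free monoids and let $A$ be a commutative ring with $1$ such that $\mathbb{Z}\subset A$. Then the following are equivalent: (1) the ring extension $A[M]\subset A[N]$ is subintegral; (2) the ring extension $A[M]\subset A[N]$ is weakly subintegral; (3) the monoid extension $M\subset N$ is subintegral.
   Context: Rings are commutative with $1$. Monoids are commutative, cancellative ($xy=zy\Rightarrow x=z$) and torsion-free ($x^n=y^n$ for some $n\ge 1$ implies $x=y$), written multiplicatively with identity $1$. $A[M]$ is the monoid algebra (free $A$-module on $M$ with multiplication induced by $M$). An extension of rings $R\subset S$ is subintegral if $S$ is integral over $R$, the map $\mathrm{Spec}(S)\to\mathrm{Spec}(R)$ is a bijection, and for each $Q\in\mathrm{Spec}(S)$ the induced map of residue fields $k(Q\cap R)\to k(Q)$ is an isomorphism. It is weakly subintegral if $S$ is integral over $R$, $\mathrm{Spec}(S)\to\mathrm{Spec}(R)$ is a bijection, and for each $Q\in\mathrm{Spec}(S)$ the residue field extension $k(Q\cap R)\hookrightarrow k(Q)$ is purely inseparable. An extension of monoids $M\subset N$ is elementary subintegral if $N=M\cup xM$ for some $x\in N$ with $x^2,x^3\in M$. It is subintegral if $N$ is a union of submonoids each of which is obtained from $M$ by a finite succession of elementary subintegral extensions. *)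

(* Defs.v *)
From HB Require Import structures.
From mathcomp Require Import all_boot all_algebra.
From mathcomp Require Import finmap.
From mathcomp.multinomials Require Import monalg.
From mathcomp.classical Require Import boolp classical_sets.

Set Implicit Arguments.
Unset Strict Implicit.
Unset Printing Implicit Defensive.

Import GRing.Theory.
Local Open Scope ring_scope.
Local Open Scope quotient_scope.

HB.mixin Record Monoid_isCommutative M of Monoid M := {
  mulgC : commutative (@monoid.mul M)
}.

#[short(type="comMonoidType")]
HB.structure Definition ComMonoid := {M of Monoid M & Monoid_isCommutative M}.

Definition cancellative (M : comMonoidType) : Prop :=
  forall x y z : M, (x * y = z * y)%g -> x = z.

Definition torsion_free (M : comMonoidType) : Prop :=
  forall (x y : M) (n : nat), (0 < n)%N -> (x ^+ n = y ^+ n)%g -> x = y.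

Section MonoidExtensions.
Local Open Scope classical_set_scope.
Local Open Scope group_scope.

Definition submonoid (N : comMonoidType) (K : set N) : Prop :=
  K 1 /\ forall x y, K x -> K y -> K (x * y).

(* [K] and [L] are submonoids of an ambient monoid [N]. *)
Definition elementary_subintegral (N : comMonoidType) (K L : set N) : Prop :=
  [/\ submonoid K, submonoid L &
      exists x : N, [/\ K (x ^+ 2), K (x ^+ 3) &
                        L = K `|` [set x * y | y in K]]].

Inductive elementary_tower (N : comMonoidType) (K : set N) : set N -> Prop :=
  | elementary_tower_refl : elementary_tower K K
  | elementary_tower_step L L' : elementary_tower K L ->
      elementary_subintegral L L' -> elementary_tower K L'.

(* A monoid extension [M] of [N] is an injective morphism [i : M -> N], the
   submonoid [M] of [N] being [range i]. *)
Definition monoid_subintegral (M N : comMonoidType)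
    (i : UMagmaMorphism.type M N) : Prop :=
  injective i /\
  exists F : set (set N),
    (forall L, F L -> submonoid L /\ elementary_tower (range i) L) /\
    \bigcup_(L in F) L = [set: N].

End MonoidExtensions.

(* The carrier is the free [A]-module [{malg A[M]}] of monalg; the product
   given there only covers monoids without nontrivial units ([monomType]), so
   it is redefined here for all commutative monoids. *)
Definition monoid_algebra (A : comNzRingType) (M : comMonoidType) : Type :=
  {malg A[M]}.

Section MonoidAlgebra.
Context (A : comNzRingType) (M : comMonoidType).
Local Notation AM := (monoid_algebra A M).
Implicit Types (g : AM) (x y : M) (a b : A).

HB.instance Definition _ := GRing.Lmodule.on AM.

Definition monom x a : AM := mkmalgU x a.

Definition ma_one : AM := monom 1%g 1.

Definition ma_mul g1 g2 : AM :=
  \sum_(x <- msupp g1) \sum_(y <- msupp g2)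
    monom (x * y)%g (mcoeff x g1 * mcoeff y g2).

Lemma ma_sum g : g = \sum_(x <- msupp g) monom x (mcoeff x g).
Proof. exact: (@monalgE M A g). Qed.

Lemma monom0 x : monom x 0 = 0. Proof. exact: monalgU0. Qed.

Lemma monomD x a b : monom x (a + b) = monom x a + monom x b.
Proof. exact: monalgUD. Qed.

Lemma ma_mulw (d1 d2 : {fset M}) g1 g2 :
  (msupp g1 `<=` d1)%fset -> (msupp g2 `<=` d2)%fset ->
  ma_mul g1 g2 = \sum_(x <- d1) \sum_(y <- d2)
                   monom (x * y)%g (mcoeff x g1 * mcoeff y g2).
Proof.
move=> le1 le2; rewrite /ma_mul (big_fset_incl _ le1) /=.
  apply/eq_bigr=> x _; apply/big_fset_incl => // y _ /mcoeff_outdom ->.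
  by rewrite mulr0 monom0.
move=> x _ /mcoeff_outdom gx.
by rewrite big1 // => y _; rewrite gx mul0r monom0.
Qed.

Lemma ma_mulC : commutative ma_mul.
Proof.
move=> g1 g2; rewrite /ma_mul exchange_big; apply/eq_bigr=> x _.
by apply/eq_bigr=> y _; rewrite mulgC mulrC.
Qed.

Lemma ma_mulDl : left_distributive ma_mul +%R.
Proof.
move=> g1 g2 g; have sg := fsubset_refl (msupp g).
rewrite (ma_mulw (msuppD_le _ _) sg) (ma_mulw (fsubsetUl _ (msupp g2)) sg).
rewrite (ma_mulw (fsubsetUr (msupp g1) _) sg).
rewrite -big_split /=; apply/eq_bigr=> x _.
rewrite -big_split /=; apply/eq_bigr=> y _.
by rewrite -monomD -mulrDl -mcoeffD.
Qed.

Lemma ma_mul0g : left_zero 0 ma_mul.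
Proof. by move=> g; apply: (addrI (ma_mul 0 g)); rewrite -ma_mulDl !addr0. Qed.

Lemma ma_mulUU x y a b :
  ma_mul (monom x a) (monom y b) = monom (x * y)%g (a * b).
Proof.
by rewrite (ma_mulw msuppU_le msuppU_le) !big_seq_fset1 !mcoeffUU.
Qed.

Lemma ma_mul_suml (I : Type) (r : seq I) (F : I -> AM) g :
  ma_mul (\sum_(i <- r) F i) g = \sum_(i <- r) ma_mul (F i) g.
Proof.
exact: (big_morph (ma_mul^~ g) (fun _ _ => ma_mulDl _ _ _) (ma_mul0g _)).
Qed.

Lemma ma_mul_sumr (I : Type) (r : seq I) (F : I -> AM) g :
  ma_mul g (\sum_(i <- r) F i) = \sum_(i <- r) ma_mul g (F i).
Proof. by rewrite ma_mulC ma_mul_suml; apply/eq_bigr => i _; rewrite ma_mulC. Qed.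

Lemma ma_mulA : associative ma_mul.
Proof.
move=> g1 g2 g3.
rewrite (ma_sum g1) !ma_mul_suml; apply/eq_bigr=> x _.
rewrite (ma_sum g2) ma_mul_suml !ma_mul_sumr ma_mul_suml; apply/eq_bigr=> y _.
rewrite (ma_sum g3) !ma_mul_sumr; apply/eq_bigr=> z _.
by rewrite !ma_mulUU mulrA mulgA.
Qed.

Lemma ma_mul1g : left_id ma_one ma_mul.
Proof.
move=> g; rewrite {1}(ma_sum g) ma_mul_sumr [RHS]ma_sum.
by apply/eq_bigr=> x _; rewrite ma_mulUU mul1r mul1g.
Qed.

Lemma ma_one_neq0 : ma_one != 0.
Proof. by rewrite monalgU_eq0 oner_eq0. Qed.

HB.instance Definition _ := GRing.Zmodule_isComNzRing.Build AM
  ma_mulA ma_mulC ma_mul1g ma_mulDl ma_one_neq0.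

Lemma monomM x y a b : monom x a * monom y b = monom (x * y)%g (a * b).
Proof. exact: ma_mulUU. Qed.

End MonoidAlgebra.

Section MonoidAlgebraMap.
Context (A : comNzRingType) (M N : comMonoidType).
Variable i : UMagmaMorphism.type M N.

Definition monoid_algebra_map (g : monoid_algebra A M) : monoid_algebra A N :=
  \sum_(x <- msupp g) monom (i x) (mcoeff x g).

Lemma ma_mapw (d : {fset M}) g : (msupp g `<=` d)%fset ->
  monoid_algebra_map g = \sum_(x <- d) monom (i x) (mcoeff x g).
Proof.
move=> le; apply: big_fset_incl => // x _ /mcoeff_outdom ->.
by rewrite monom0.
Qed.

Lemma ma_mapU x a : monoid_algebra_map (monom x a) = monom (i x) a.
Proof. by rewrite (ma_mapw msuppU_le) big_seq_fset1 mcoeffUU. Qed.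

Lemma ma_map_is_zmod_morphism : zmod_morphism monoid_algebra_map.
Proof.
move=> g1 g2.
rewrite (ma_mapw (msuppB_le _ _)) (ma_mapw (fsubsetUl _ (msupp g2))).
rewrite (ma_mapw (fsubsetUr (msupp g1) _)) -sumrB.
by apply/eq_bigr=> x _; rewrite mcoeffB [LHS]monalgUB.
Qed.

HB.instance Definition _ := GRing.isZmodMorphism.Build _ _ monoid_algebra_map
  ma_map_is_zmod_morphism.

Lemma ma_map_is_monoid_morphism : GRing.monoid_morphism monoid_algebra_map.
Proof.
split=> [|g1 g2]; first by rewrite [LHS]ma_mapU gmulf1.
rewrite (ma_sum g1) (ma_sum g2) mulr_suml !raddf_sum /= mulr_suml.
apply/eq_bigr=> x _; rewrite mulr_sumr raddf_sum /= mulr_sumr.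
by apply/eq_bigr=> y _; rewrite monomM !ma_mapU monomM gmulfM.
Qed.

HB.instance Definition _ := GRing.isMonoidMorphism.Build _ _ monoid_algebra_map
  ma_map_is_monoid_morphism.

Lemma ma_map_inj : injective i -> injective monoid_algebra_map.
Proof.
move=> i_inj; apply: raddf_inj => g g0; apply/(malgP (g : {malg A[M]})) => x.
have: mcoeff (i x) (monoid_algebra_map g) = 0 by rewrite g0 mcoeff0.
have [xg|/mcoeff_outdom -> _] := boolP (x \in msupp g); last by rewrite mcoeff0.
rewrite /monoid_algebra_map raddf_sum (big_fsetD1 x) //= mcoeffUU.
rewrite big1_fset ?addr0 ?mcoeff0 // => y; rewrite in_fsetD1 => /andP[yx _] _.
by rewrite mcoeffU (inj_eq i_inj) (negPf yx).
Qed.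

End MonoidAlgebraMap.

Arguments monoid_algebra_map A {M N} i.

(* A point of Spec R is a [P : prime_idealr R]: classically every prime ideal
   has a boolean membership predicate, and by [prime_idealr_ext] equality in
   [prime_idealr R] is equality of ideals, so that [bijective (spec_map f)]
   below is bijectivity of Spec S -> Spec R. *)
Lemma prime_idealr_ext (R : comNzRingType) (P Q : prime_idealr R) :
  (P : pred R) =i (Q : pred R) -> P = Q.
Proof.
case: P Q => [P cP] [Q cQ] /= PQ.
have {}PQ : P = Q by apply/funext => x; exact: PQ.
case: Q / PQ cQ => cQ; congr PrimeIdealr.Pack.
case: cP cQ => [[a1] [a2] [a3] [a4]] [[b1] [b2] [b3] [b4]].
have -> : a1 = b1 by exact: Prop_irrelevance.
have -> : a2 = b2 by exact: Prop_irrelevance.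
have -> : a3 = b3 by exact: Prop_irrelevance.
by have -> : a4 = b4 by exact: Prop_irrelevance.
Qed.

Section Contraction.
Context (R S : comNzRingType) (f : {rmorphism R -> S}).

Definition contraction (Q : prime_idealr S) (x : R) : bool := f x \in (Q : pred S).

Lemma contractionE Q x : (x \in contraction Q) = (f x \in (Q : pred S)).
Proof. by []. Qed.

Lemma contraction_idealr Q : idealr_closed (contraction Q).
Proof.
split=> [||a x y]; rewrite !contractionE.
- by rewrite rmorph0; exact: (idealr0 Q).
- by rewrite rmorph1; exact/negbT/(idealr1 Q).
- move=> xQ yQ; rewrite rmorphD rmorphM.
  by apply: rpredD => //; apply: (idealMr (idealrI := Q)).
Qed.

Lemma contraction_prime Q : prime_idealr_closed (contraction Q).
Proof. by move=> x y; rewrite !contractionE rmorphM prime_idealrM. Qed.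

HB.instance Definition _ Q :=
  isIdealr.Build R (contraction Q) (contraction_idealr Q).
HB.instance Definition _ Q :=
  isPrimeIdealrClosed.Build R (contraction Q) (@contraction_prime Q).

Definition spec_map (Q : prime_idealr S) : prime_idealr R :=
  PrimeIdealr.clone R (contraction Q) _.

End Contraction.

Definition domain_quot (R : comNzRingType) (P : prime_idealr R) : Type :=
  {ideal_quot P}.

Section DomainQuotient.
Context (R : comNzRingType) (P : prime_idealr R).
Local Notation RP := (domain_quot P).

HB.instance Definition _ := GRing.ComNzRing.on RP.

Definition dq_class (x : R) : RP := \pi_{ideal_quot P} x.

Lemma dq_classK (x : RP) : dq_class (repr (x : {ideal_quot P})) = x.
Proof. exact: reprK. Qed.

Lemma dq_class_eq x y : (dq_class x == dq_class y) = (x - y \in (P : pred R)).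
Proof. by rewrite Quotient.idealrBE. Qed.

Lemma dq_class_is_zmod_morphism : zmod_morphism dq_class.
Proof. exact: (rmorphB (\pi_{ideal_quot P})). Qed.

HB.instance Definition _ :=
  GRing.isZmodMorphism.Build _ _ dq_class dq_class_is_zmod_morphism.

Lemma dq_class_is_monoid_morphism : GRing.monoid_morphism dq_class.
Proof.
by split; [exact: (rmorph1 (\pi_{ideal_quot P}))
          |exact: (rmorphM (\pi_{ideal_quot P}))].
Qed.

HB.instance Definition _ :=
  GRing.isMonoidMorphism.Build _ _ dq_class dq_class_is_monoid_morphism.

Definition dq_unit (x : RP) : bool := `[< exists y, y * x = 1 >].

Definition dq_inv (x : RP) : RP :=
  if pselect (exists y, y * x = 1) is left h then projT1 (cid h) else x.

Lemma dq_mulVr : {in dq_unit, left_inverse 1 dq_inv *%R}.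
Proof.
move=> x /asboolP h; rewrite /dq_inv; case: pselect => // h'.
exact: (projT2 (cid h')).
Qed.

Lemma dq_unitPl (x y : RP) : y * x = 1 -> dq_unit x.
Proof. by move=> h; apply/asboolP; exists y. Qed.

Lemma dq_inv_out : {in [predC dq_unit], dq_inv =1 id}.
Proof.
by move=> x /asboolPn h; rewrite /dq_inv; case: pselect => // h'; case: h.
Qed.

HB.instance Definition _ := GRing.ComNzRing_hasMulInverse.Build RP
  dq_mulVr dq_unitPl dq_inv_out.

Lemma dq_integral : GRing.integral_domain_axiom RP.
Proof. exact: (@Quotient.rquot_IdomainAxiom R P). Qed.

HB.instance Definition _ := GRing.ComUnitRing_isIntegral.Build RP dq_integral.

End DomainQuotient.

Definition residue_field (R : comNzRingType) (P : prime_idealr R) : fieldType :=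
  {fraction (domain_quot P)}.

(* Only meaningful, and only proved to be a ring morphism, when [g] is an
   injective ring morphism; see [frac_mapE]. *)
Definition frac_map (D E : idomainType) (g : D -> E) (x : {fraction D}) :
    {fraction E} :=
  FracField.tofrac (g \n_(repr x)) / FracField.tofrac (g \d_(repr x)).

Section FracMap.
Context (D E : idomainType) (g : {rmorphism D -> E}).
Hypothesis g_inj : injective g.
Local Notation "x %:F" := (FracField.tofrac x).

Lemma frac_repr (x : {fraction D}) : x = (\n_(repr x))%:F / (\d_(repr x))%:F.
Proof.
have d0 : (\d_(repr x))%:F != 0 by rewrite tofrac_eq0 denom_ratioP.
apply: (canRL (mulfK d0)); rewrite -{1}[x]reprK; unlock FracField.tofrac.
rewrite -[LHS]FracField.pi_mul; apply/eqmodP => /=.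
rewrite FracField.equivfE /FracField.mulf !numden_Ratio ?mulr1 ?oner_eq0 ?denom_ratioP //.
by rewrite mulrC.
Qed.

Lemma frac_mapE (n d : D) : d != 0 -> frac_map g (n%:F / d%:F) = (g n)%:F / (g d)%:F.
Proof.
move=> d0; rewrite /frac_map; set x := n%:F / d%:F.
have rd0 := denom_ratioP (repr x).
have gd0 (y : D) : y != 0 -> (g y)%:F != 0.
  by move=> y0; rewrite tofrac_eq0 raddf_eq0.
have := frac_repr x; rewrite {1}/x => /eqP.
rewrite !eqr_div ?tofrac_eq0 // -!rmorphM tofrac_eq => /eqP h.
apply/eqP; rewrite eqr_div ?gd0 // -!rmorphM.
by rewrite -h.
Qed.

Lemma frac_map_tofrac (x : D) : frac_map g x%:F = (g x)%:F.
Proof.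
by rewrite -[x%:F]divr1 -(rmorph1 (@FracField.tofrac D)) frac_mapE ?oner_eq0 //
   !rmorph1 divr1.
Qed.

Lemma frac_map_is_zmod_morphism : zmod_morphism (frac_map g).
Proof.
move=> x y; rewrite (frac_repr x) (frac_repr y).
have := denom_ratioP (repr x); have := denom_ratioP (repr y).
set d := \d_(repr y); set n := \n_(repr y).
set d' := \d_(repr x); set n' := \n_(repr x) => d0 d'0.
have gd0 (z : D) : z != 0 -> (g z)%:F != 0.
  by move=> z0; rewrite tofrac_eq0 raddf_eq0.
rewrite -mulNr addf_div ?tofrac_eq0 // -rmorphN -!rmorphM -rmorphD.
rewrite !frac_mapE ?mulf_neq0 // -mulNr addf_div ?gd0 //.
by rewrite !rmorphD !rmorphM !rmorphN.
Qed.

Lemma frac_map_is_monoid_morphism : GRing.monoid_morphism (frac_map g).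
Proof.
split; first by rewrite -(rmorph1 (@FracField.tofrac D)) frac_map_tofrac !rmorph1.
move=> x y; rewrite (frac_repr x) (frac_repr y).
have := denom_ratioP (repr x); have := denom_ratioP (repr y) => d0 d'0.
by rewrite mulf_div -!rmorphM !frac_mapE ?mulf_neq0 // mulf_div !rmorphM.
Qed.

End FracMap.

Section ResidueMap.
Context (R S : comNzRingType) (f : {rmorphism R -> S}) (Q : prime_idealr S).
Local Notation P := (spec_map f Q).

Definition quot_map (x : domain_quot P) : domain_quot Q :=
  dq_class Q (f (repr (x : {ideal_quot P}))).

Lemma quot_mapE (x : R) : quot_map (dq_class P x) = dq_class Q (f x).
Proof.
apply/eqP; rewrite dq_class_eq -rmorphB.
by have := dq_classK (dq_class P x) => /eqP; rewrite dq_class_eq.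
Qed.

Lemma quot_map_is_zmod_morphism : zmod_morphism quot_map.
Proof.
move=> x y; rewrite -(dq_classK x) -(dq_classK y) -rmorphB !quot_mapE.
by rewrite !rmorphB.
Qed.

HB.instance Definition _ :=
  GRing.isZmodMorphism.Build _ _ quot_map quot_map_is_zmod_morphism.

Lemma quot_map_is_monoid_morphism : GRing.monoid_morphism quot_map.
Proof.
split=> [|x y]; first by rewrite -(rmorph1 (dq_class P)) quot_mapE !rmorph1.
by rewrite -(dq_classK x) -(dq_classK y) -rmorphM !quot_mapE !rmorphM.
Qed.

HB.instance Definition _ :=
  GRing.isMonoidMorphism.Build _ _ quot_map quot_map_is_monoid_morphism.

Lemma quot_map_inj : injective quot_map.
Proof.
move=> x y; rewrite -(dq_classK x) -(dq_classK y) !quot_mapE => /eqP.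
by rewrite dq_class_eq -rmorphB => h; apply/eqP; rewrite dq_class_eq.
Qed.

Definition residue_map : residue_field P -> residue_field Q :=
  frac_map quot_map.

HB.instance Definition _ := GRing.isZmodMorphism.Build _ _ residue_map
  (frac_map_is_zmod_morphism quot_map_inj).

HB.instance Definition _ := GRing.isMonoidMorphism.Build _ _ residue_map
  (frac_map_is_monoid_morphism quot_map_inj).

Lemma residue_mapE (x : R) :
  residue_map (FracField.tofrac (dq_class P x)) =
  FracField.tofrac (dq_class Q (f x)).
Proof. by rewrite -quot_mapE; exact: (frac_map_tofrac quot_map_inj). Qed.

End ResidueMap.

Arguments residue_map {R S} f Q.

(* The analogue of [purely_inseparable] of separable.v for extensions which
   need not be finite: in characteristic p the exponents [n] are the powers of
   p, in characteristic 0 the only exponent is 1. *)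
Definition purely_inseparable_ext (K L : fieldType) (f : {rmorphism K -> L}) :
    Prop :=
  forall y : L, exists2 n : nat, [pchar L].-nat n & exists x : K, f x = y ^+ n.

(* A ring extension is an injective morphism [f : R -> S]. *)
Definition subintegral (R S : comNzRingType) (f : {rmorphism R -> S}) : Prop :=
  [/\ injective f, integralRange f, bijective (spec_map f) &
      forall Q : prime_idealr S, bijective (residue_map f Q)].

Definition weakly_subintegral (R S : comNzRingType) (f : {rmorphism R -> S}) :
    Prop :=
  [/\ injective f, integralRange f, bijective (spec_map f) &
      forall Q : prime_idealr S, purely_inseparable_ext (residue_map f Q)].

(* Main.v *)
(* (3) says that for every y in N all large powers of y lie in M: conversely one
   adjoins y^(c-1), y^(c-2), ..., y in turn.  It implies (1) because a
   ring map h from A[M] to a field K then extends uniquely to A[N], the value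
   t at y being determined by t^n = h(y^n) for large n, and maps to fields see
   primes and residue fields.  For (2) => (3), let y1, y2 be the two images of y
   in A[N] (x)_{A[M]} A[N].  Weak subintegrality makes y1 - y2 vanish in every
   residue field of characteristic 0, so c (y1 - y2)^k = 0 for some integer
   c > 0; as some power of y lies in M, this improves to c' y1^e (y1 - y2) = 0.
   Since Z is contained in A, (y^(e+1), 1) and (y^e, y) are then identified in
   N x N modulo (a m, b) ~ (a, m b), and this puts two consecutive powers of y
   in M. *)
Require Import Defs.
From HB Require Import structures.
From mathcomp Require Import all_boot all_algebra finmap.
From mathcomp Require Import zify ring.
From mathcomp.multinomials Require Import monalg.
From mathcomp.classical Require Import boolp classical_sets.

Set Implicit Arguments.
Unset Strict Implicit.
Unset Printing Implicit Defensive.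

Import GRing.Theory.
Local Open Scope ring_scope.
Local Open Scope classical_set_scope.

(** * Elementary towers and large powers of an element *)

Section Monoids.
Local Open Scope group_scope.
Variable N : comMonoidType.
Implicit Types (K L : set N) (x y z : N).

Lemma mulgAC x y z : x * y * z = x * z * y.
Proof. by rewrite -!mulgA (mulgC y). Qed.

Lemma mulgCA x y z : x * (y * z) = y * (x * z).
Proof. by rewrite !mulgA (mulgC x). Qed.

Lemma expgMnC x y n : (x * y) ^+ n = x ^+ n * y ^+ n.
Proof. by apply: expgMn; apply: mulgC. Qed.

Lemma submonoidX K x n : submonoid K -> K x -> K (x ^+ n).
Proof.
move=> [K1 KM] Kx; elim: n => [//|n IH]; rewrite expgS; exact: KM.
Qed.

Definition powers_eventually_in K y :=
  exists c, forall n, (c <= n)%N -> K (y ^+ n).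

(** Every large [n] is [2 k + 3 e] with [k] and [e] both large, so [y^n] is a product of large
    powers of [y^2] and [y^3]. *)
Lemma eventually_in_step K L y : submonoid K ->
  (forall z, L z -> powers_eventually_in K z) -> L (y ^+ 2) -> L (y ^+ 3) ->
  powers_eventually_in K y.
Proof.
move=> [_ KM] LK /LK [c2 h2] /LK [c3 h3].
(* [e] is [2 c3] or [2 c3 + 1], matching the parity of [n]; the bound then leaves [k >= c2]. *)
exists (2 * c2 + 3 * (2 * c3 + 1))%N => n len.
have [k [e [-> ck ce]]] : exists k e, [/\ n = (2 * k + 3 * e)%N, (c2 <= k)%N & (c3 <= e)%N].
  case: (boolP (odd n)) => on.
    exists ((n - 3 * (2 * c3 + 1)) %/ 2)%N, (2 * c3 + 1)%N; split; lia.
  exists ((n - 3 * (2 * c3)) %/ 2)%N, (2 * c3)%N; split; lia.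
by rewrite expgnDr !expgnA; apply: KM; [apply: h2|apply: h3].
Qed.

Lemma tower_eventually_in K L : submonoid K -> elementary_tower K L ->
  forall y, L y -> powers_eventually_in K y.
Proof.
move=> sK; elim=> [y Ky|L1 L2 tL IH [sL1 sL2 [x [x2 x3 ->]]] y].
  by exists 0%N => n _; apply: submonoidX.
case=> [/IH //|[z L1z <-]].
(* The new element is [x z]; its square and cube are back in [L1]. *)
by apply: (eventually_in_step sK IH); rewrite expgMnC; apply: (proj2 sL1) => //;
  apply: submonoidX.
Qed.

(** For a submonoid [K], this is generated by [K] and all [y^n] with [n >= j]: it is [K[y]] for
    [j = 1], and [K] itself once all these powers lie in [K]. *)
Definition adjoin_powers K y j : set N :=
  [set z | exists m n, [/\ K m, n = 0%N \/ (j <= n)%N & z = m * y ^+ n]].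

Lemma adjoin_powers_submonoid K y j : submonoid K -> submonoid (adjoin_powers K y j).
Proof.
move=> [K1 KM]; split.
  by exists 1, 0%N; rewrite mulg1; split=> //; left.
move=> _ _ [m [n [Km hn ->]]] [m' [n' [Km' hn' ->]]].
exists (m * m'), (n + n')%N; split; [exact: KM | lia |].
by rewrite expgnDr -!mulgA (mulgA (y ^+ n)) (mulgC _ m') -mulgA.
Qed.

(** Only the exponent [j] is new, and [2 j], [3 j] exceed [j] since [j > 0]. *)
Lemma adjoin_powers_elementary K y j : submonoid K -> (0 < j)%N ->
  elementary_subintegral (adjoin_powers K y j.+1) (adjoin_powers K y j).
Proof.
move=> sK j0; split; try exact: adjoin_powers_submonoid.
have K1 := proj1 sK.
exists (y ^+ j); split.
- by exists 1, (j * 2)%N; rewrite mul1g expgnA; split => //; right; lia.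
- by exists 1, (j * 3)%N; rewrite mul1g expgnA; split => //; right; lia.
apply/seteqP; split=> z.
  move=> [m [n [Km hn ->]]].
  have [->|nj] := eqVneq n j.
    right; exists m; last by rewrite mulgC.
    by exists m, 0%N; rewrite mulg1; split=> //; left.
  by left; exists m, n; split=> //; lia.
case=> [[m [n [Km hn ->]]]|[_ [m [n [Km hn ->]]] <-]].
  by exists m, n; split=> //; lia.
exists m, (j + n)%N; split=> //; first by right; lia.
by rewrite expgnDr mulgA (mulgC _ m) mulgA.
Qed.

(** The index descends from [c + 1], where nothing is adjoined, to 1, one elementary step at a
    time. *)
Lemma adjoin_powers_tower K y : submonoid K -> powers_eventually_in K y ->
  elementary_tower K (adjoin_powers K y 1).
Proof.
move=> sK [c hc].
have KE : adjoin_powers K y c.+1 = K.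
  apply/seteqP; split=> z; last first.
    by move=> Kz; exists z, 0%N; rewrite mulg1; split=> //; left.
  move=> [m [n [Km [->|cn] ->]]]; first by rewrite mulg1.
  by apply: (proj2 sK) => //; apply: hc; lia.
have main j : (j <= c)%N -> elementary_tower K (adjoin_powers K y (c.+1 - j)).
  elim: j => [_|j IH jc]; first by rewrite subn0 KE; constructor.
  apply: elementary_tower_step (IH (ltnW jc)) _.
  have -> : (c.+1 - j)%N = (c.+1 - j.+1).+1 by lia.
  by apply: adjoin_powers_elementary => //; lia.
by have := main c (leqnn _); rewrite subSnn.
Qed.

End Monoids.

Lemma range_submonoid (M N : comMonoidType) (i : UMagmaMorphism.type M N) :
  submonoid (range i).
Proof.
split; first by exists 1%g => //; rewrite gmulf1.
by move=> _ _ [x _ <-] [y _ <-]; exists (x * y)%g => //; rewrite gmulfM.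
Qed.

Lemma monoid_subintegralP (M N : comMonoidType) (i : UMagmaMorphism.type M N) :
  injective i ->
  monoid_subintegral i <-> forall y, powers_eventually_in (range i) y.
Proof.
move=> i_inj; have sM := range_submonoid i; split=> [[_ [F [FT FU]]] y|h].
  have : [set: N] y by [].
  rewrite -FU => -[L /FT[_ tL] Ly]; exact: tower_eventually_in tL _ Ly.
split=> //; exists [set L | submonoid L /\ elementary_tower (range i) L].
split=> //; apply/seteqP; split=> // y _.
exists (adjoin_powers (range i) y 1); last first.
  by exists 1%g, 1%N; rewrite mul1g; split=> //; [apply: (proj1 sM)|right].
split; [exact: adjoin_powers_submonoid | exact: adjoin_powers_tower].
Qed.

(** * Ring morphisms out of a monoid algebra *)

Section Evaluation.
Variables (A : comNzRingType) (N : comMonoidType).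
Local Notation AN := (monoid_algebra A N).

Definition ma_const (a : A) : AN := monom 1%g a.

Lemma ma_const_is_zmod_morphism : zmod_morphism ma_const.
Proof. by move=> a b; rewrite /ma_const [LHS]monalgUB. Qed.

HB.instance Definition _ :=
  GRing.isZmodMorphism.Build _ _ ma_const ma_const_is_zmod_morphism.

Lemma ma_const_is_monoid_morphism : GRing.monoid_morphism ma_const.
Proof. by split=> // a b; rewrite /ma_const monomM mulg1. Qed.

HB.instance Definition _ :=
  GRing.isMonoidMorphism.Build _ _ ma_const ma_const_is_monoid_morphism.

Lemma monom_const (x : N) a : monom x a = ma_const a * monom x 1.
Proof. by rewrite /ma_const monomM mul1g mulr1. Qed.

Lemma monomX (x : N) n : monom x 1 ^+ n = monom (x ^+ n)%g 1 :> AN.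
Proof.
elim: n => [//|n IH]; by rewrite exprS IH monomM mulr1 expgS.
Qed.

Lemma ma_rmorph_ext (K : comNzRingType) (F G : {rmorphism AN -> K}) :
  (forall a, F (ma_const a) = G (ma_const a)) ->
  (forall x, F (monom x 1) = G (monom x 1)) -> F =1 G.
Proof.
move=> FGc FGx g; rewrite (ma_sum g) !raddf_sum; apply: eq_bigr => x _.
by rewrite /= monom_const !rmorphM FGc FGx.
Qed.

Variables (K : comNzRingType) (h : {rmorphism A -> K}) (v : N -> K).
Hypotheses (v1 : v 1%g = 1) (vM : forall x y, v (x * y)%g = v x * v y).

Definition ma_eval (g : AN) : K := \sum_(x <- msupp g) h (mcoeff x g) * v x.

Lemma ma_evalw (d : {fset N}) g : (msupp g `<=` d)%fset ->
  ma_eval g = \sum_(x <- d) h (mcoeff x g) * v x.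
Proof.
move=> le; apply: big_fset_incl => // x _ /mcoeff_outdom ->.
by rewrite rmorph0 mul0r.
Qed.

Lemma ma_evalU x a : ma_eval (monom x a) = h a * v x.
Proof. by rewrite (ma_evalw msuppU_le) big_seq_fset1 mcoeffUU. Qed.

Lemma ma_eval_is_zmod_morphism : zmod_morphism ma_eval.
Proof.
move=> g1 g2.
rewrite (ma_evalw (msuppB_le _ _)) (ma_evalw (fsubsetUl _ (msupp g2))).
rewrite (ma_evalw (fsubsetUr (msupp g1) _)) -sumrB.
by apply/eq_bigr=> x _; rewrite mcoeffB rmorphB mulrBl.
Qed.

HB.instance Definition _ := GRing.isZmodMorphism.Build _ _ ma_eval
  ma_eval_is_zmod_morphism.

Lemma ma_eval_is_monoid_morphism : GRing.monoid_morphism ma_eval.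
Proof.
split=> [|g1 g2]; first by rewrite [LHS]ma_evalU rmorph1 v1 mulr1.
rewrite (ma_sum g1) (ma_sum g2) mulr_suml !raddf_sum /= mulr_suml.
apply/eq_bigr=> x _; rewrite mulr_sumr raddf_sum /= mulr_sumr.
by apply/eq_bigr=> y _; rewrite monomM !ma_evalU rmorphM vM mulrACA.
Qed.

Lemma ma_eval_rmorphism : exists F : {rmorphism AN -> K}, F =1 ma_eval.
Proof.
pose m := GRing.isMonoidMorphism.Build _ _ ma_eval ma_eval_is_monoid_morphism.
pose F : {rmorphism AN -> K} := HB.pack ma_eval m.
by exists F.
Qed.

End Evaluation.

(** * Extending maps to a field from [A[M]] to [A[N]] *)

Section Extension.
Variables (A : comNzRingType) (M N : comMonoidType).
Variable (i : UMagmaMorphism.type M N).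
Hypothesis i_inj : injective i.
Hypothesis pow_in : forall y, powers_eventually_in (range i) y.
Local Notation AM := (monoid_algebra A M).
Local Notation AN := (monoid_algebra A N).
Local Notation f := (monoid_algebra_map A i).

Lemma ma_map_const a : f (ma_const M a) = ma_const N a.
Proof. by rewrite /ma_const ma_mapU gmulf1. Qed.

Lemma ma_integral : integralRange f.
Proof.
move=> g; rewrite (ma_sum g); apply: big_ind.
- exact: integral0.
- by move=> u v; apply: integral_add.
move=> x _; rewrite monom_const; apply: integral_mul.
  by rewrite -ma_map_const; apply: integral_id.
have [c hc] := pow_in x; have [m _ im] := hc c.+1 (leqnSn _).
exists ('X^(c.+1) - (monom m 1)%:P); first exact: monicXnsubC.
rewrite /root rmorphB /= map_polyXn map_polyC /= hornerD hornerN hornerXn hornerC.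
by rewrite monomX ma_mapU im subrr.
Qed.

Section Field.
Variable K : fieldType.

(** Dividing the equalities at two consecutive exponents gives [s = t], unless [t = 0], when [s] is
    nilpotent and hence zero. *)
Lemma exp_eq_field (s t : K) c : (forall n, (c <= n)%N -> s ^+ n = t ^+ n) -> s = t.
Proof.
move=> h; have := h c.+2 (leqW (leqnSn _)); rewrite !(exprS _ c.+1) h // => e.
have := mulIf _ e; have [t0|t0 ->//] := eqVneq t 0; last by rewrite expf_neq0.
have := h c.+1 (leqnSn _); rewrite t0 expr0n /= => /eqP.
by rewrite expf_eq0 /= => /eqP ->.
Qed.

Lemma ma_map_extension_unique (F G : {rmorphism AN -> K}) :
  (forall g, F (f g) = G (f g)) -> F =1 G.
Proof.
move=> FG; apply: ma_rmorph_ext => [a|x]; first by rewrite -ma_map_const.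
have [c hc] := pow_in x; apply: (@exp_eq_field _ _ c) => n /hc [m _ im].
by rewrite -!rmorphXn /= monomX -im -ma_mapU.
Qed.

Variable h : {rmorphism AM -> K}.

(** Characterises the value at [y] of an extension of [h], testing only large powers of [y], on
    which [h] is already defined. *)
Definition power_value (y : N) (t : K) :=
  exists c, forall n m, (c <= n)%N -> i m = (y ^+ n)%g -> t ^+ n = h (monom m 1).

Lemma power_value_unique y s t : power_value y s -> power_value y t -> s = t.
Proof.
move=> [c hc] [d hd]; have [e he] := pow_in y.
apply: (@exp_eq_field _ _ (c + d + e)) => n len.
have [m _ im] := he n ltac:(lia).
by rewrite (hc n m) ?(hd n m) //; lia.
Qed.

Lemma power_valueM x y s t : power_value x s -> power_value y t ->
  power_value (x * y)%g (s * t).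
Proof.
move=> [c hc] [d hd]; have [e he] := pow_in y; have [e' he'] := pow_in x.
exists (c + d + e + e')%N => n m len.
have [m1 _ im1] := he n ltac:(lia).
have [m2 _ im2] := he' n ltac:(lia).
rewrite expgMnC -im1 -im2 -gmulfM => /i_inj ->.
rewrite exprMn (hc n m2) ?(hd n m1) //; try lia.
by rewrite -rmorphM /= monomM mulr1.
Qed.

Lemma power_value_map m : power_value (i m) (h (monom m 1)).
Proof.
exists 0%N => n m' _; rewrite -gmulfXn => /i_inj ->.
by rewrite -monomX rmorphXn.
Qed.

Lemma power_value_exists y : exists t, power_value y t.
Proof.
(* The successor makes [c], hence every exponent [n >= c], positive. *)
have [c' hc'] := pow_in y; pose c := c'.+1.
have [r hr] : {r : nat -> M & forall n, (c <= n)%N -> i (r n) = (y ^+ n)%g}.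
  apply: (@choice _ _ (fun n m => (c <= n)%N -> i m = (y ^+ n)%g)) => n.
  have [cn|nc] := leqP c n.
    by have [m _ im] := hc' n (ltnW cn); exists m.
  by exists 1%g.
pose v n := h (monom (r n) 1).
have vM m n : (c <= m)%N -> (c <= n)%N -> v (m + n)%N = v m * v n.
  move=> cm cn; rewrite /v -rmorphM /= monomM mulr1; congr (h (monom _ _)).
  by apply: i_inj; rewrite gmulfM !hr // ?expgnDr //; lia.
have vX m n : (c <= m)%N -> (0 < n)%N -> v (n * m)%N = v m ^+ n.
  move=> cm; case: n => // n _; elim: n => [|n IH]; first by rewrite mul1n.
  by rewrite mulSn vM ?IH -?exprS //; nia.
(* If [v c] is nonzero, [v (n (c+1)) = v n * v (n c)] shows that the [n]-th power of this ratio is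
   [v n]. *)
exists (v c.+1 / v c); exists c => n m cn im.
have -> : m = r n by apply: i_inj; rewrite im hr.
rewrite -/(v n).
have n0 : (0 < n)%N by lia.
(* If [v c = 0], the ratio is 0 because [0^-1 = 0], and [v n] vanishes too since
   [(v n)^c = (v c)^n]. *)
have [vc0|vc0] := eqVneq (v c) 0.
  rewrite vc0 invr0 mulr0 expr0n; case: eqP => [|_]; first by lia.
  have := vX n c cn isT; rewrite mulnC vX // vc0 expr0n.
  case: eqP => [|_ /esym/eqP]; first by lia.
  by rewrite expf_eq0 => /andP[_ /eqP ->].
have -> : v n = v n * v c ^+ n / v c ^+ n by rewrite mulfK // expf_neq0.
rewrite exprMn exprVn; congr (_ / _).
rewrite -(vX c.+1 n (leqnSn c) n0) -(vX c n (leqnn c) n0).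
rewrite -vM ?leq_pmull //; by rewrite mulnS.
Qed.

(** The values are chosen element by element; their uniqueness makes the choice multiplicative. *)
Lemma ma_map_extension : exists F : {rmorphism AN -> K}, forall g, F (f g) = h g.
Proof.
have [v hv] := choice power_value_exists.
pose h0 : {rmorphism A -> K} := h \o @ma_const A M.
have v_map m : v (i m) = h (monom m 1).
  exact: power_value_unique (hv _) (power_value_map _).
have v1 : v 1%g = 1.
  by rewrite -[1%g in LHS](gmulf1 (s := i)) v_map [monom _ _](_ : _ = 1) ?rmorph1.
have vM x y : v (x * y)%g = v x * v y.
  by apply: (power_value_unique (hv _)); apply: power_valueM.
have [F FE] := @ma_eval_rmorphism A N K h0 v v1 vM.
exists F; apply: (@ma_rmorph_ext A M K (F \o f) h) => [a|x] /=.
  by rewrite ma_map_const FE ma_evalU v1 mulr1.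
by rewrite ma_mapU FE ma_evalU v_map rmorph1 mul1r.
Qed.

End Field.
End Extension.

(** * Primes, residue fields and maps to fields *)

Section KernelPrime.
Variables (S : comNzRingType) (K : fieldType) (F : {rmorphism S -> K}).

Definition rmorph_kernel (x : S) : bool := F x == 0.

Lemma rmorph_kernel_idealr : idealr_closed rmorph_kernel.
Proof.
split=> [||a x y]; rewrite !unfold_in /rmorph_kernel ?rmorph0 ?rmorph1 ?oner_eq0 //.
by rewrite rmorphD rmorphM => /eqP -> /eqP ->; rewrite mulr0 addr0.
Qed.

Lemma rmorph_kernel_prime : prime_idealr_closed rmorph_kernel.
Proof.
by move=> x y; rewrite !unfold_in /rmorph_kernel rmorphM mulf_eq0.
Qed.

HB.instance Definition _ := isIdealr.Build S rmorph_kernel rmorph_kernel_idealr.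
HB.instance Definition _ :=
  isPrimeIdealrClosed.Build S rmorph_kernel rmorph_kernel_prime.

Definition kernel_prime : prime_idealr S := PrimeIdealr.clone S rmorph_kernel _.

End KernelPrime.

Section ResidueClass.
Variables (R : comNzRingType) (P : prime_idealr R).

Definition residue_class : {rmorphism R -> residue_field P} :=
  @FracField.tofrac (domain_quot P) \o dq_class P.

Lemma residue_class_eq0 x : (residue_class x == 0) = (x \in (P : pred R)).
Proof.
by rewrite /= tofrac_eq0 -(rmorph0 (dq_class P)) dq_class_eq subr0.
Qed.

Lemma residue_fraction (z : residue_field P) :
  exists n d, residue_class d != 0 /\ z = residue_class n / residue_class d.
Proof.
exists (repr (\n_(repr z) : {ideal_quot P})), (repr (\d_(repr z) : {ideal_quot P})).
rewrite /= !dq_classK; split; last exact: frac_repr.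
by rewrite tofrac_eq0 denom_ratioP.
Qed.

End ResidueClass.

Lemma injective_surjective_bijective (T U : Type) (g : T -> U) :
  injective g -> (forall y, exists x, g x = y) -> bijective g.
Proof.
move=> g_inj /choice[s gs]; exists s => // x; exact: g_inj.
Qed.

(* Maps to fields see exactly the primes together with their residue fields,
   so unique extendability of all of them makes the map on spectra bijective
   with trivial residue field extensions. *)
Lemma subintegral_of_field_extensions (R S : comNzRingType) (f : {rmorphism R -> S}) :
  injective f -> integralRange f ->
  (forall (K : fieldType) (h : {rmorphism R -> K}),
     exists F : {rmorphism S -> K}, forall x, F (f x) = h x) ->
  (forall (K : fieldType) (F G : {rmorphism S -> K}),
     (forall x, F (f x) = G (f x)) -> F =1 G) ->
  subintegral f.
Proof.
move=> f_inj f_int f_ext f_uniq.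
have factor (Q : prime_idealr S) (F : {rmorphism S -> residue_field (spec_map f Q)}) :
    (forall x, F (f x) = residue_class (spec_map f Q) x) ->
    forall y, residue_class Q y = residue_map f Q (F y).
  move=> Ff; apply: (f_uniq _ _ (residue_map f Q \o F)) => x.
  by rewrite [RHS]/= Ff /= residue_mapE.
split=> //; [|move=> Q].
  apply: injective_surjective_bijective => [Q Q' eqP|P].
    (* Every prime [Q0] over [P] is the kernel of the same [F], whence injectivity on spectra. *)
    have memQ P (F : {rmorphism S -> residue_field P}) :
        (forall x, F (f x) = residue_class P x) ->
        forall Q0, spec_map f Q0 = P -> forall y, (y \in (Q0 : pred S)) = (F y == 0).
      move=> + Q0 eQ0; case: P / eQ0 F => F Ff y.
      by rewrite -residue_class_eq0 (factor _ F Ff) fmorph_eq0.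
    have [F Ff] := f_ext _ (residue_class (spec_map f Q)).
    apply: prime_idealr_ext => y.
    by rewrite (memQ _ F Ff Q erefl) (memQ _ F Ff Q' (esym eqP)).
  have [F Ff] := f_ext _ (residue_class P).
  exists (kernel_prime F); apply: prime_idealr_ext => x.
  by rewrite -(residue_class_eq0 P) -Ff.
apply: injective_surjective_bijective => [|z]; first exact: fmorph_inj.
have [F Ff] := f_ext _ (residue_class (spec_map f Q)).
have [n [d [d0 ->]]] := residue_fraction z.
by exists (F n / F d); rewrite rmorphM fmorphV !(factor _ F Ff).
Qed.

Lemma subintegral_weakly (R S : comNzRingType) (f : {rmorphism R -> S}) :
  subintegral f -> weakly_subintegral f.
Proof.
move=> [f_inj f_int f_spec f_res]; split=> // Q y.
have [s _ sK] := f_res Q.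
exists 1%N; first by [].
by exists (s y); exact: sK.
Qed.

(** * Prime ideals avoiding a multiplicative set *)

Definition ideal_set (T : comNzRingType) (I : set T) :=
  I 0 /\ forall a u v, I u -> I v -> I (a * u + v).

(** By Zorn: an ideal maximal among those containing [I] and missing [W] is prime. *)
Lemma prime_ideal_avoiding (T : comNzRingType) (I W : set T) :
  ideal_set I -> W 1 -> (forall u v, W u -> W v -> W (u * v)) ->
  (forall w, W w -> ~ I w) ->
  exists Q : prime_idealr T,
    (forall x, I x -> x \in (Q : pred T)) /\
    (forall w, W w -> w \notin (Q : pred T)).
Proof.
move=> idI W1 WM WI.
pose good (J : set T) :=
  [/\ ideal_set J, I `<=` J & forall w, W w -> ~ J w].
have [|J [PJ maxJ]] := @Zorn_bigcup _ (fun J => J = set0 \/ good J).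
  move=> F FP tot; have [[J0 [FJ0 gJ0]]|noF] := pselect (exists J, F J /\ good J).
    have idF J u : F J -> J u -> good J by move=> /FP[->|].
    right; split; first split.
    - by exists J0 => //; case: gJ0 => -[].
    - move=> a u v [J FJ Ju] [J' FJ' J'v].
      have [[_ hJ] _ _] := idF _ _ FJ Ju; have [[_ hJ'] _ _] := idF _ _ FJ' J'v.
      have [le|le] := tot _ _ FJ FJ'.
        by exists J' => //; apply: hJ' => //; apply: le.
      by exists J => //; apply: hJ => //; apply: le.
    - by move=> x Ix; exists J0 => //; case: gJ0 => _ le _; apply: le.
    - by move=> w Ww [J FJ Jw]; have [_ _ /(_ w Ww)] := idF _ _ FJ Jw.
  left; apply/seteqP; split=> // x [J FJ Jx].
  by case: (FP J FJ) => [J0|gJ]; [rewrite -J0|case: noF; exists J].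
have gI : good I by split.
have gJ : good J.
  case: PJ => // J0; case: (maxJ I); last by right.
  by rewrite J0; split=> // /(_ 0 (proj1 idI)).
have [[J0 JD] IJ WJ] := gJ.
(* By maximality, [J + T u] meets [W] when [u] is outside [J]. *)
have extend u : ~ J u -> exists a r, J a /\ W (a + r * u).
  move=> nJu; apply: contrapT => noW.
  pose Ju := [set x | exists a r, J a /\ x = a + r * u].
  have JJu : J `<=` Ju by move=> x Jx; exists x, 0; rewrite mul0r addr0.
  apply: (maxJ Ju).
    split=> // /(_ u); apply: contra_not nJu; apply.
    by exists 0, 1; rewrite add0r mul1r.
  right; split.
  - split; first exact: JJu.
    move=> b _ _ [a [r [Ja ->]]] [a' [r' [Ja' ->]]].
    exists (b * a + a'), (b * r + r'); split; first exact: JD.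
    by ring.
  - by move=> x /IJ/JJu.
  - by move=> w Ww [a [r [Ja e]]]; apply: noW; exists a, r; rewrite -e.
have Jideal : idealr_closed (fun x => `[< J x >]).
  split; rewrite ?unfold_in; first exact/asboolP.
    by apply/asboolPn; apply: WJ.
  by move=> a u v /asboolP Ju /asboolP Jv; apply/asboolP; apply: JD.
have Jprime : prime_idealr_closed (fun x => `[< J x >]).
  move=> u v /asboolP Juv; rewrite !unfold_in.
  case: asboolP => //= nJu; apply/asboolP; apply: contrapT => nJv.
  have [a [r [Ja Wa]]] := extend u nJu; have [b [t [Jb Wb]]] := extend v nJv.
  apply: (WJ _ (WM _ _ Wa Wb)).
  (* The product of the two elements of [W] lies in [J], as [a], [b] and [u v] do. *)
  rewrite (_ : _ * _ = (b + t * v) * a + (r * u * b + (r * t * (u * v) + 0))); last by ring.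
  by apply: (JD) => //; apply: (JD) => //; apply: (JD).
pose mI := isIdealr.Build T _ Jideal.
pose mP := isPrimeIdealrClosed.Build T _ Jprime.
pose Q : prime_idealr T := HB.pack (fun x => `[< J x >]) mI mP.
by exists Q; split=> x ?; [apply/asboolP; apply: IJ|apply/asboolPn; apply: WJ].
Qed.

(** * Integrality puts a positive power of each element in [M] *)

Lemma integral_power (A : comNzRingType) (M N : comMonoidType)
    (i : UMagmaMorphism.type M N) : cancellative N ->
  integralRange (monoid_algebra_map A i) ->
  forall w, exists2 r, (0 < r)%N & range i (w ^+ r)%g.
Proof.
move=> N_cancel int w; apply: contrapT => now.
have [p mp] := int (monom w 1); rewrite /root => /eqP.
have szp : (size (map_poly (monoid_algebra_map A i) p) <= size p)%N.
  exact: size_poly.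
rewrite (horner_coef_wide _ szp).
have p0 : (0 < size p)%N by rewrite lt0n size_poly_eq0 monic_neq0.
move: mp; rewrite monicE lead_coefE; set d := (size p).-1.
have -> : size p = d.+1 by rewrite prednK.
move=> /eqP pd; rewrite big_ord_recr /= coef_map pd /= rmorph1 mul1r.
(* At [w^d] the leading term contributes 1, whereas a term [x w^k] with [k < d] contributes only if
   [i x = w^(d-k)], which [now] excludes. *)
move=> /(congr1 (mcoeff (w ^+ d)%g)); rewrite mcoeffD monomX mcoeffUU mcoeff0.
rewrite raddf_sum big1 ?add0r => [/eqP|k _]; first by rewrite oner_eq0.
rewrite coef_map monomX /= /monoid_algebra_map mulr_suml raddf_sum big1 // => x _.
rewrite monomM mulr1 /= /monom mcoeffU; case: eqP => // e; case: now.
exists (d - k)%N; first by rewrite subn_gt0.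
exists x => //; apply: (N_cancel _ (w ^+ k)%g).
by rewrite e -expgnDr subnK // ltnW.
Qed.

(** * The tensor square of [A[N]] over [A[M]] *)

Definition monoid_square (N : comMonoidType) : Type := (N * N)%type.

Section MonoidSquare.
Local Open Scope group_scope.
Variable N : comMonoidType.
Local Notation N2 := (monoid_square N).

HB.instance Definition _ := Choice.on N2.

Definition sq_mul (p q : N2) : N2 := (p.1 * q.1, p.2 * q.2).
Definition sq_one : N2 := (1, 1).

Lemma sq_mulA : associative sq_mul.
Proof. by move=> [a b] [c d] [e g]; rewrite /sq_mul /= !mulgA. Qed.
Lemma sq_mul1g : left_id sq_one sq_mul.
Proof. by move=> [a b]; rewrite /sq_mul /= !mul1g. Qed.
Lemma sq_mulg1 : right_id sq_one sq_mul.
Proof. by move=> [a b]; rewrite /sq_mul /= !mulg1. Qed.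
Lemma sq_mulC : commutative sq_mul.
Proof. by move=> [a b] [c d]; rewrite /sq_mul /= mulgC (mulgC b). Qed.

HB.instance Definition _ := isMonoid.Build N2 sq_mulA sq_mul1g sq_mulg1.
HB.instance Definition _ := Monoid_isCommutative.Build N2 sq_mulC.

Definition sq_left (x : N) : N2 := (x, 1).
Definition sq_right (x : N) : N2 := (1, x).

Lemma sq_left_morphism : monoid.monoid_morphism sq_left.
Proof. by split=> // x y; congr pair; rewrite mulg1. Qed.
Lemma sq_right_morphism : monoid.monoid_morphism sq_right.
Proof. by split=> // x y; congr pair; rewrite mulg1. Qed.

HB.instance Definition _ := isUMagmaMorphism.Build N N2 sq_left sq_left_morphism.
HB.instance Definition _ := isUMagmaMorphism.Build N N2 sq_right sq_right_morphism.

Definition sqL : UMagmaMorphism.type N N2 := UMagmaMorphism.clone N N2 sq_left _.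
Definition sqR : UMagmaMorphism.type N N2 := UMagmaMorphism.clone N N2 sq_right _.

End MonoidSquare.

Section TensorSquare.
Variables (A : comNzRingType) (M N : comMonoidType).
Variable i : UMagmaMorphism.type M N.
Local Notation N2 := (monoid_square N).
Local Notation AN2 := (monoid_algebra A N2).
Local Notation j1 := (monoid_algebra_map A (sqL N)).
Local Notation j2 := (monoid_algebra_map A (sqR N)).

Definition balanced (C : set N2) :=
  forall (m : M) (a b : N), C ((a * i m)%g, b) <-> C (a, (i m * b)%g).

(** The linear functional attached to the indicator function of [C]. That function need not be
    multiplicative; only additivity of [ma_eval] is used. *)
Definition sum_on (C : set N2) : AN2 -> A :=
  ma_eval idfun (fun x => (`[< C x >])%:R).

HB.instance Definition _ C := GRing.Additive.on (sum_on C).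

Lemma sum_onU C x a : sum_on C (monom x a) = a * (`[< C x >])%:R.
Proof. exact: ma_evalU. Qed.

(* The kernel of A[N x N] -> A[N] (x)_{A[M]} A[N]: the tensor product is free
   on the quotient of N x N by the congruence (a m, b) ~ (a, m b), and the
   balanced sets are the unions of classes of this congruence. *)
Definition tensor_ideal : set AN2 :=
  [set g | forall C, balanced C -> sum_on C g = 0].

Lemma sum_on_monomM C p a g :
  sum_on C (monom p a * g) = a * sum_on [set q | C (p * q)%g] g.
Proof.
rewrite (ma_sum g) mulr_sumr !raddf_sum mulr_sumr; apply: eq_bigr => q _ /=.
by rewrite monomM !sum_onU mulrA.
Qed.

Lemma balanced_shift C p : balanced C -> balanced [set q | C (p * q)%g].
Proof.
case: p => p1 p2 bC m a b.
have := bC m (p1 * a)%g (p2 * b)%g.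
by rewrite (mulgA (i m)) (mulgC (i m)) -!mulgA.
Qed.

(** Multiplication by a monomial translates the set [C], and translates of balanced sets are
    balanced. *)
Lemma tensor_ideal_ideal : ideal_set tensor_ideal.
Proof.
split=> [C _|g u v Iu Iv C bC]; first by rewrite raddf0.
rewrite raddfD /= Iv // addr0 (ma_sum g) mulr_suml raddf_sum big1 // => p _ /=.
by rewrite sum_on_monomM Iu ?mulr0 //; apply: balanced_shift.
Qed.

Lemma tensor_ideal_map g :
  tensor_ideal (j1 (monoid_algebra_map A i g) - j2 (monoid_algebra_map A i g)).
Proof.
move=> C bC; rewrite {2 4}/monoid_algebra_map (raddf_sum j1) (raddf_sum j2) -sumrB.
rewrite raddf_sum big1 // => m _; rewrite /= !ma_mapU raddfB /= !sum_onU /=.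
have := bC m 1%g 1%g; rewrite mul1g mulg1 => CE.
by rewrite (asbool_equiv_eq CE) subrr.
Qed.

End TensorSquare.

(** * The difference of the two images of an element *)

Section Separation.
Variables (R S T : comNzRingType) (f : {rmorphism R -> S}).
Variables (j1 j2 : {rmorphism S -> T}) (I : set T).
Hypotheses (I_ideal : ideal_set I) (f_weak : weakly_subintegral f).
Hypothesis I_map : forall x, I (j1 (f x) - j2 (f x)).

(* If not, a prime containing [I] but none of these elements contracts to two
   primes of [S] over the same prime of [R], hence to a single prime [Q] with
   residue characteristic 0; then [y] agrees modulo [Q] with a fraction from
   [R], on which [j1] and [j2] coincide. *)
Lemma weakly_subintegral_separation (y : S) :
  exists c k, I (c.+1%:R * (j1 y - j2 y) ^+ k).
Proof.
set s := j1 y - j2 y; apply: contrapT => noI.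
pose W : set T := [set w | exists c k, w = c.+1%:R * s ^+ k].
have [||w [c [k ->]] Iw|Q [IQ WQ]] := @prime_ideal_avoiding T I W I_ideal.
- by exists 0%N, 0%N; rewrite mul1r.
- move=> _ _ [c [k ->]] [d [l ->]]; exists (c.+1 * d.+1).-1, (k + l)%N.
  by rewrite prednK ?muln_gt0 // natrM exprD mulrACA.
- by apply: noI; exists c, k.
have [_ _ spec_bij purely] := f_weak.
have jf x : (j1 (f x) \in (Q : pred T)) = (j2 (f x) \in (Q : pred T)).
  have dQ := IQ _ (I_map x); apply/idP/idP => h.
    by rewrite -[j2 _](subKr (j1 (f x))) rpredB.
  by rewrite -[j1 _](subrK (j2 (f x))) rpredD.
have eqQ : spec_map j1 Q = spec_map j2 Q.
  by apply: (bij_inj spec_bij); apply: prime_idealr_ext => x; exact: jf.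
pose Q1 := spec_map j1 Q.
have [n n_char [x ex]] := purely Q1 (residue_class Q1 y).
(* A prime factor [p] of [n] would vanish in the residue field at [Q1], so [p] would lie in [Q]; but
   [p = p s^0] is in [W]. *)
have n1 : n = 1%N.
  apply/eqP; apply: contraT => n_neq1.
  have n0 : (0 < n)%N by case/andP: n_char.
  have pn : prime (pdiv n) by rewrite pdiv_prime //; lia.
  have /andP[_] := pnatP _ n0 n_char _ pn (pdiv_dvd n).
  rewrite -(rmorph_nat (residue_class Q1)) residue_class_eq0.
  have -> : ((pdiv n)%:R \in (Q1 : pred S)) = (j1 (pdiv n)%:R \in (Q : pred T)) by [].
  rewrite rmorph_nat; apply/contraLR => _; apply: WQ.
  by exists (pdiv n).-1, 0%N; rewrite mulr1 prednK // pdiv_gt0.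
have [a [b [b0 xE]]] := residue_fraction x.
have rc z : residue_map f Q1 (residue_class _ z) = residue_class Q1 (f z).
  exact: residue_mapE.
have fb0 : residue_class Q1 (f b) != 0 by rewrite -rc fmorph_eq0.
have yQ1 : f b * y - f a \in (Q1 : pred S).
  rewrite -residue_class_eq0 rmorphB rmorphM.
  move: ex; rewrite n1 expr1 xE fmorph_div /= !rc => <-.
  by rewrite mulrC divfK // subrr.
have yQ2 : f b * y - f a \in (spec_map j2 Q : pred S) by rewrite -eqQ.
have y1 : j1 (f b * y - f a) \in (Q : pred T) by [].
have y2 : j2 (f b * y - f a) \in (Q : pred T) by [].
(* Both images of [b y - a] lie in [Q]; in their difference, [j1] and [j2] may be interchanged on
   [a] and [b] modulo [I]. *)
have : j1 (f b) * s \in (Q : pred T).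
  rewrite (_ : _ * s = j1 (f b * y - f a) - j2 (f b * y - f a)
      + (j1 (f a) - j2 (f a)) - j2 y * (j1 (f b) - j2 (f b))).
    apply: rpredB; last by apply: (idealMr (idealrI := Q)); apply: IQ.
    by apply: rpredD; [exact: rpredB | exact: IQ].
  by rewrite !rmorphB !rmorphM /s; ring.
rewrite prime_idealrM => /orP[bQ|sQ].
  by move: fb0; rewrite residue_class_eq0 => /negP; apply.
have Ws : W s by exists 0%N, 1%N; rewrite mul1r.
by move: (WQ s Ws); rewrite sQ.
Qed.

(** First-order binomial expansion; for [n = 0] the junk exponent [n.-1] is killed by the
    coefficient [n]. *)
Lemma exp_sub_linear (a s : T) n :
  exists h, (a - s) ^+ n = a ^+ n - n%:R * a ^+ n.-1 * s + s ^+ 2 * h.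
Proof.
elim: n => [|n [h IH]]; first by exists 0; rewrite !expr0; ring.
exists (a * h + n%:R * a ^+ n.-1 - s * h).
have e : n%:R * a ^+ n = a * (n%:R * a ^+ n.-1).
  by case: n {IH} => [|n]; rewrite ?mul0r ?mulr0 // exprS mulrCA.
have e1 : n.+1%:R * a ^+ n = a ^+ n + a * (n%:R * a ^+ n.-1).
  by rewrite -e -natr1; ring.
by rewrite exprS IH /= e1 (exprS a n); ring.
Qed.

(** With [s = y1 - y2], the element [y1^n - y2^n] of [I] is [n y1^(n-1) s] modulo [s^2]. Multiplying
    it by [c y1^e s^k] trades [s^(k+2)] for [s^(k+1)], at the cost of a factor [n y1^(n-1)]. *)
Lemma ideal_linear_descent (y : S) n : (0 < n)%N -> I (j1 y ^+ n - j2 y ^+ n) ->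
  (exists c k, I (c.+1%:R * (j1 y - j2 y) ^+ k)) ->
  exists c e, I (c.+1%:R * (j1 y ^+ e * (j1 y - j2 y))).
Proof.
move=> n0 In [c [k Ik]]; have [I0 ID] := I_ideal.
have IM a u : I u -> I (a * u) by move=> Iu; rewrite -[_ * _]addr0; apply: ID.
set s := j1 y - j2 y in Ik *.
have [e {}Ik] : exists e, I (c.+1%:R * (j1 y ^+ e * s ^+ k)).
  by exists 0%N; rewrite mul1r.
elim: k c e Ik => [|k IH] c e Ik.
  exists c, e; have -> : c.+1%:R * (j1 y ^+ e * s) = s * (c.+1%:R * (j1 y ^+ e * s ^+ 0)).
    by rewrite expr0; ring.
  exact: IM.
case: k => [|k] in IH Ik *; first by exists c, e.
have [h hE] := exp_sub_linear (j1 y) s n.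
have j2E : j2 y = j1 y - s by rewrite subKr.
apply: (IH (c.+1 * n).-1 (e + n.-1)%N); rewrite prednK ?muln_gt0 //.
rewrite (_ : _ * _ = c.+1%:R * j1 y ^+ e * s ^+ k * (j1 y ^+ n - j2 y ^+ n)
    + (h * (c.+1%:R * (j1 y ^+ e * s ^+ k.+2)) + 0)).
  by apply: (ID) => //; apply: (ID).
rewrite j2E hE natrM exprD !exprS; ring.
Qed.

End Separation.

(** * From the tensor square back to powers of [y] *)

Section Powers.
Variables (M N : comMonoidType) (i : UMagmaMorphism.type M N).
Hypothesis N_cancel : cancellative N.
Local Notation N2 := (monoid_square N).
Local Open Scope group_scope.

Lemma two_consecutive_powers (y : N) k : range i (y ^+ k) -> range i (y ^+ k.+1) ->
  powers_eventually_in (range i) y.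
Proof.
move=> yk yk1; have sM := range_submonoid i; exists (k * k)%N => n kn.
have [k0|k0] := posnP k.
  by apply: submonoidX => //; rewrite k0 in yk1.
(* For [n >= k^2] the quotient by [k] is at least [k], hence exceeds the remainder, and the
   subtraction is exact. *)
have -> : n = (k.+1 * (n %% k) + k * (n %/ k - n %% k))%N.
  have h1 := divn_eq n k; have h2 := ltn_pmod n k0.
  have h3 : (k <= n %/ k)%N by rewrite leq_divRL.
  move: h1 h2 h3; set q := (n %/ k)%N; set r := (n %% k)%N => -> h2 h3.
  rewrite mulSn mulnBr; have : (k * r <= k * q)%N by rewrite leq_mul2l; lia.
  by lia.
by rewrite expgnDr !expgnA; apply: (proj2 sM); apply: submonoidX.
Qed.

(* For [d = e.+1] this set contains [(y ^+ e.+1, 1)], whereas membership of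
   [(y ^+ e, y)] puts two consecutive powers of [y] in [M]. *)
Definition power_fiber (y : N) (d : nat) : set N2 :=
  [set p | p.1 * p.2 = y ^+ d /\
    exists l m, range i (y ^+ l) /\ p.1 * y ^+ l = y ^+ d * i m].

(** The second condition makes [a / y^d] a fraction of elements of [M] with a power of [y] as
    denominator. To divide by [m] within such fractions, note that [y^(d r) = a^r m^r b^r] is a
    multiple of [m] in [M] when [a^r] and [b^r] are in [M]. *)
Lemma power_fiber_balanced y d :
  (forall w, exists2 r, (0 < r)%N & range i (w ^+ r)) ->
  balanced i (power_fiber y d).
Proof.
move=> int m a b; have [Mone MM] := range_submonoid i.
split=> -[/= ab [l [m' [yl e]]]]; split=> /=; try by rewrite -ab mulgA.
- have [ra ra0 [ma _ ia]] := int a; have [rb rb0 [mb _ ib]] := int b.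
  pose r := (ra * rb)%N.
  have [r' rE] : exists r', r = r'.+1 by exists r.-1; rewrite prednK ?muln_gt0 ?ra0.
  have ar : a ^+ r = i (ma ^+ rb) by rewrite /r expgnA -ia gmulfXn.
  have br : b ^+ r = i (mb ^+ ra) by rewrite /r mulnC expgnA -ib gmulfXn.
  have yr : y ^+ (d * r) = i (ma ^+ rb * m ^+ r * mb ^+ ra).
    by rewrite expgnA -ab !expgMnC ar br -gmulfXn -!gmulfM.
  exists (l + d * r)%N, (m' * (ma ^+ rb * m ^+ r' * mb ^+ ra)); split.
    by rewrite expgnDr; apply: MM => //; rewrite yr; exists (ma ^+ rb * m ^+ r * mb ^+ ra).
  rewrite expgnDr mulgA yr (gmulfM m') (mulgA (y ^+ d)) -e rE expgS !gmulfM.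
  by rewrite (mulgCA _ (i m)) -(mulgA (i m)) (mulgA (a * _)) (mulgAC a).
- exists l, (m * m'); split=> //.
  by rewrite gmulfM mulgAC e -mulgA (mulgC (i m')).

Qed.

(** Cancelling [y^e] gives [y^l = y * i m], so [y^(r+l-1) = y^r * i m] lies in [M], next to
    [y^(r+l)]. *)
Lemma power_fiber_powers y e : (exists2 r, (0 < r)%N & range i (y ^+ r)) ->
  power_fiber y e.+1 (y ^+ e, y) -> powers_eventually_in (range i) y.
Proof.
move=> [r r0 yr] [_ [l [m [yl /= e1]]]].
have sM := range_submonoid i.
have yl1 : y ^+ l = y * i m.
  by apply: (N_cancel (z := _) (y := y ^+ e)); rewrite mulgC e1 expgS mulgAC.
have e2 : y ^+ (r + l).-1 = y ^+ r * i m.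
  apply: (N_cancel (y := y)); rewrite -expgSr prednK ?addn_gt0 ?r0 //.
  by rewrite expgnDr yl1 mulgA mulgAC.
apply: (@two_consecutive_powers y (r + l).-1).
  by rewrite e2; apply: (proj2 sM) => //; exists m.
by rewrite prednK ?addn_gt0 ?r0 // expgnDr; apply: (proj2 sM).
Qed.

End Powers.

(** * Weak subintegrality forces large powers into [M]; the equivalence *)

Lemma weakly_subintegral_powers (A : comNzRingType) (M N : comMonoidType)
    (i : UMagmaMorphism.type M N) :
  cancellative N -> injective (intr : int -> A) ->
  weakly_subintegral (monoid_algebra_map A i) ->
  forall y, powers_eventually_in (range i) y.
Proof.
move=> N_cancel Z_sub_A wsub y.
have int := integral_power N_cancel (let: And4 _ h _ _ := wsub in h).
have [n n0 [m _ im]] := int y.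
have I_ideal := tensor_ideal_ideal A i.
have I_map := @tensor_ideal_map A M N i.
have In := I_map (monom m 1); rewrite ma_mapU im -monomX !rmorphXn /= in In.
have [c [e]] := ideal_linear_descent I_ideal n0 In
  (weakly_subintegral_separation I_ideal wsub I_map (monom y 1)).
have bD := @power_fiber_balanced M N i y e.+1 int.
rewrite -rmorphXn monomX /= !ma_mapU mulrBr !monomM => /(_ _ bD).
rewrite mulr_natl raddfMn raddfB /= !sum_onU !mul1r.
have fL : power_fiber i y e.+1 (sq_left (y ^+ e) * sq_left y)%g.
  split; first by rewrite /= !mulg1 expgSr.
  exists 0%N, 1%g; split; first exact: (proj1 (range_submonoid i)).
  by rewrite /= !gmulf1 !mulg1 expgSr.
rewrite (asboolT fL); have -> : (sq_left (y ^+ e) * sq_right y)%g = ((y ^+ e)%g, y).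
  by congr pair; rewrite /= ?mulg1 ?mul1g.
(* If [(y^e, y)] were outside the fiber, the functional would give [c + 1 = 0] in [A]. *)
case: asboolP => [fR _|_]; first exact: power_fiber_powers (int y) fR.
rewrite subr0 => c0; suff : Posz c.+1 = 0 by [].
by apply: Z_sub_A; rewrite rmorph0 -c0.
Qed.

Theorem theorem1p1 (M N : comMonoidType) (i : UMagmaMorphism.type M N)
    (A : comNzRingType)
    (M_cancel : cancellative M) (M_torsion_free : torsion_free M)
    (N_cancel : cancellative N) (N_torsion_free : torsion_free N)
    (i_inj : injective i)
    (Z_sub_A : injective (intr : int -> A)) :
  [<-> subintegral (monoid_algebra_map A i);
       weakly_subintegral (monoid_algebra_map A i);
       monoid_subintegral i].
Proof.
tfae=> [|/(weakly_subintegral_powers N_cancel Z_sub_A) pow_in|].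
- exact: subintegral_weakly.
- exact/monoid_subintegralP.
move=> /(monoid_subintegralP i_inj) pow_in.
apply: subintegral_of_field_extensions => [|||K F G].
- exact: ma_map_inj.
- exact: ma_integral.
- exact: ma_map_extension.
- exact: ma_map_extension_unique.
Qed.
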